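(* Let $\emptyset\ne T\subseteq[n-1]$. For $\omega\in S_n$ let $\rho_\omega$ be the fundamental cycle of $\overline\Pi_\omega$. Then the set $\{\rho_\omega:\omega\in S_n,\ \omega(n)=n$ and $\omega(n-1)\in T\}$ forms a basis for $\widetilde H_{n-3}(\overline{\Pi_n(T)};\mathbb{Z})$.
   Context: $\Pi_n$ is the lattice of set partitions of $[n]$ ordered by refinement. $\Pi_n(T)$ is the induced subposet of $\Pi_n$ consisting of all partitions $\pi$ such that the block of $\pi$ containing $n$ is either a singleton or meets $T$ (it is the intersection lattice of the arrangement $\{x_i=x_j:1\le i<j\le n-1\}\cup\{x_n=x_i:i\in T\}$ in $\mathbb{R}^n$). $\overline{\Pi_n(T)}$ denotes $\Pi_n(T)$ with its minimum and maximum removed; homology is that of the order complex. To split $\omega\in S_n$ at positions $i_1<\dots<i_k$ in $[n-1]$ is to form the partition with blocks $\{\omega(1),\dots,\omega(i_1)\},\{\omega(i_1+1),\dots,\omega(i_2)\},\dots,\{\omega(i_k+1),\dots,\omega(n)\}$ (no positions gives the one-block partition). $\Pi_\omega$ is the induced subposet of $\Pi_n$ of all partitions obtained by splitting $\omega$; it is a Boolean lattice, so the order complex of its proper part $\overline\Pi_\omega$ is an $(n-3)$-sphere, whose fundamental cycle (up to sign) is $\rho_\omega$. *)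

(* Defs.v *)
From HB Require Import structures.
From mathcomp Require Import all_boot all_order all_fingroup all_algebra.
From mathcomp Require Import boolp.

Set Implicit Arguments.
Unset Strict Implicit.
Unset Printing Implicit Defensive.

Import Order.TTheory GRing.Theory.
Local Open Scope ring_scope.

Definition is_Zbasis (M : zmodType) (I : finType) (b : I -> M) : Prop :=
  forall x : M, exists! c : {ffun I -> int}, x = \sum_i b i *~ c i.

Section ReducedHomology.
Context {disp : Order.disp_t} {V : finPOrderType disp}.
Implicit Types (P s t : {set V}) (d : int).

Definition proper_part P : {set V} :=
  [set x in P | ~~ [forall y in P, (x <= y)%O] & ~~ [forall y in P, (y <= x)%O]].

Definition order_complex P : {set {set V}} :=
  [set s : {set V} | (s \subset P) && [forall x in s, forall y in s, (x >=< y)%O]].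

(* All chain groups live in this one group; the degree and the subposet are
   imposed as conditions on the support, so that the map on chains induced by
   an inclusion of subposets is the identity. *)
Definition schain : zmodType := {ffun {set V} -> int}.

(* A simplex of dimension d has d + 1 vertices; the empty simplex, of dimension
   -1, is included, so the homology below is reduced. *)
Definition is_schain d P (c : schain) : bool :=
  [forall s, (c s != 0) ==> (s \in order_complex P) && (#|s|%:Z == d + 1)].

(* The linear extension of
   [x_0 < ... < x_k] |-> \sum_i (-1)^i [x_0 < ... omit x_i ... < x_k]. *)
Definition sboundary (c : schain) : schain :=
  [ffun t => \sum_(s : {set V}) \sum_(x in s | s :\ x == t)
               (-1) ^+ #|[set y in s | (y < x)%O]| * c s].

Lemma sboundaryB : {morph sboundary : a b / a - b}.
Proof.
move=> a b; apply/ffunP=> t; rewrite !ffunE -sumrB; apply: eq_bigr => s _.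
by rewrite -sumrB; apply: eq_bigr => x _; rewrite !ffunE mulrBr.
Qed.

Lemma sboundary0 : sboundary 0 = 0.
Proof. by rewrite -[X in sboundary X](subrr 0) sboundaryB subrr. Qed.

Lemma is_schain0 d P : is_schain d P 0.
Proof. by apply/forallP=> s; rewrite ffunE eqxx. Qed.

Lemma is_schainB d P a b :
  is_schain d P a -> is_schain d P b -> is_schain d P (a - b).
Proof.
move=> /forallP ha /forallP hb; apply/forallP=> s; apply/implyP.
rewrite !ffunE; have [a0|a0 _] := eqVneq (a s) 0; last exact: (implyP (ha s)).
have [b0|b0 _] := eqVneq (b s) 0; last exact: (implyP (hb s)).
by rewrite a0 b0 subrr eqxx.
Qed.

Definition is_cycle d P : {pred schain} :=
  [pred c | is_schain d P c && (sboundary c == 0)].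

Lemma is_cycle_zmod_closed d P : zmod_closed (is_cycle d P).
Proof.
split=> [|a b]; rewrite !inE ?is_schain0 ?sboundary0 ?eqxx //.
move=> /andP[ha /eqP a0] /andP[hb /eqP b0].
by rewrite is_schainB //= sboundaryB a0 b0 subrr.
Qed.

HB.instance Definition _ d P :=
  GRing.isZmodClosed.Build schain (is_cycle d P) (is_cycle_zmod_closed d P).

Record cycles d P := Cycle { cycle_val :> schain; _ : cycle_val \in is_cycle d P }.

HB.instance Definition _ d P := [isSub for @cycle_val d P].
HB.instance Definition _ d P := [Choice of cycles d P by <:].
HB.instance Definition _ d P := [SubChoice_isSubZmodule of cycles d P by <:].

Definition is_boundary d P : {pred cycles d P} :=
  [pred z : cycles d P |
    `[< exists2 c : schain, is_schain (d + 1) P c & sboundary c = val z >]].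

Lemma is_boundary_zmod_closed d P : zmod_closed (@is_boundary d P).
Proof.
split=> [|a b]; rewrite !inE.
  by apply/asboolP; exists 0; [exact: is_schain0 | rewrite sboundary0 raddf0].
move=> /asboolP[x hx ex] /asboolP[y hy ey]; apply/asboolP.
by exists (x - y); [exact: is_schainB | rewrite sboundaryB ex ey raddfB].
Qed.

HB.instance Definition _ d P :=
  GRing.isZmodClosed.Build (cycles d P) (@is_boundary d P)
    (is_boundary_zmod_closed d P).

Definition homology d P : zmodType := Quotient.quot (@is_boundary d P).

Definition homology_class d P (c : schain) (hc : c \in is_cycle d P) :
  homology d P := \pi_(Quotient.quot (@is_boundary d P))%qT (Cycle hc).

Definition homology_basis d P (I : finType) (z : I -> schain) : Prop :=
  exists hz : forall i, z i \in is_cycle d P,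
    is_Zbasis (fun i => homology_class (hz i)).

(* A generator of the infinite cyclic group homology d P, for P whose order
   complex is a d-sphere. It is determined up to sign. *)
Definition fundamental_cycle d P (z : schain) : Prop :=
  homology_basis d P (fun _ : unit => z).

End ReducedHomology.

Arguments schain {disp} V.

Definition setpart (n : nat) := {B : {set {set 'I_n}} | partition B [set: 'I_n]}.
HB.instance Definition _ n := SubFinite.on (setpart n).

Section Refinement.
Variable n : nat.
Implicit Types p q r : setpart n.

Definition refines p q : bool :=
  [forall A in val p, exists B in val q, A \subset B].

Lemma refines_refl : reflexive refines.
Proof. by move=> p; apply/forall_inP=> A hA; apply/exists_inP; exists A. Qed.

Lemma refines_trans : transitive refines.
Proof.
move=> q p r /forall_inP pq /forall_inP qr; apply/forall_inP=> A /pq.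
move=> /exists_inP[B /qr/exists_inP[C hC BC] AB]; apply/exists_inP.
by exists C => //; apply: subset_trans BC.
Qed.

Lemma refines_sub p q : refines p q -> refines q p -> val p \subset val q.
Proof.
move=> /forall_inP pq /forall_inP qp; apply/subsetP=> A hA.
have /exists_inP[B hB AB] := pq A hA; have /exists_inP[C hC BC] := qp B hB.
have /and3P[_ /trivIsetP triv /negP p0] := valP p.
have [AC|neq] := eqVneq A C.
  by suff -> : A = B by []; apply/eqP; rewrite eqEsubset AB AC BC.
have := triv A C hA hC neq.
rewrite disjoints_subset => AC; case: p0.
suff /eqP <- : A == set0 by [].
have AsubC := subset_trans AB BC.
by rewrite -subset0 -(setICr C) subsetI AsubC AC.
Qed.

Lemma refines_anti : antisymmetric refines.
Proof.
move=> p q /andP[pq qp]; apply/val_inj/eqP.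
by rewrite eqEsubset !refines_sub.
Qed.

End Refinement.

Fact refinement_display : Order.disp_t. Proof. exact: (Order.Disp tt tt). Qed.

HB.instance Definition _ n := Order.Le_isPOrder.Build refinement_display
  (setpart n) (@refines_refl n) (@refines_anti n) (@refines_trans n).

(* The set [n+1] is 'I_n.+1, with k represented by the ordinal k - 1; in
   particular its largest element is ord_max. *)
Definition PiT n (T : {set 'I_n.+1}) : {set setpart n.+1} :=
  [set p : setpart n.+1 |
    (pblock (val p) ord_max == [set ord_max])
    || ~~ [disjoint pblock (val p) ord_max & T]].

(* s is the increasing sequence i_1 < ... < i_k of splitting positions. With
   0-based ordinals the positions i_a + 1, ..., i_(a+1) of w are the j such that
   i_a <= j < i_(a+1), where i_0 = 0 and i_(k+1) = n. *)
Definition split_blocks n (w : 'S_n) (s : seq nat) : {set {set 'I_n}} :=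
  [set B in [seq [set w j | j : 'I_n & (p.1 <= j < p.2)%N]
            | p <- zip (0 :: s)%N (rcons s n)]].

(* The sets of splitting positions in {1, ..., n-1} are the images of the
   I : {set 'I_n.-1} under i |-> i + 1; enum I is increasing. *)
Definition Pi_perm n (w : 'S_n) : {set setpart n} :=
  [set p : setpart n | [exists I : {set 'I_n.-1},
    val p == split_blocks w [seq (i : 'I_n.-1).+1 | i <- enum I]]].

(* Main.v *)
Require Import Defs.
From HB Require Import structures.
From mathcomp Require Import all_boot all_order all_fingroup all_algebra.
From mathcomp Require Import boolp zify.

(* Since n - 3 is the top dimension, the homology group is the group of cycles.
   Call a maximal chain of partitions a hook chain if in all its members the
   block of n is the only nontrivial one. A top cycle is determined by its
   values on hook chains: any other maximal chain has a member x such that the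
   block of n is the same just below x and strictly larger just above x. Every
   partition that can replace x has a larger block of n than x, so the cycle
   condition expresses the coefficient of the chain through those of chains
   with a larger total size of the blocks of n. The same induction shows that a
   common divisor of the coefficients on hook chains divides all coefficients.
   The hook chains of Pi_n(T) correspond to the w with w(n) = n and w(n-1) in T
   (the block of n grows by w(n-1), w(n-2), ...), and the one given by w is the
   only hook chain of Pi_w. Its coefficient in rho_w thus divides rho_w and is
   1 or -1 because rho_w is a generator. So the matrix of coefficients of the
   rho_w on the hook chains is diagonal with entries 1 and -1. *)

Set Implicit Arguments.
Unset Strict Implicit.
Unset Printing Implicit Defensive.

Import Order.TTheory GRing.Theory.
Local Open Scope ring_scope.

Section InjectiveIntoSeq.
Variables (X : finType) (T : eqType) (f : X -> T) (A : {set X}) (r : seq T).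
Hypotheses (f_inj : {in A &, injective f}) (f_r : {in A, forall x, f x \in r}).

Let uniq_image : uniq [seq f x | x <- enum A].
Proof.
rewrite map_inj_in_uniq ?enum_uniq // => x y; rewrite !mem_enum.
exact: f_inj.
Qed.

Let image_sub : {subset [seq f x | x <- enum A] <= r}.
Proof. by move=> _ /mapP[x + ->]; rewrite mem_enum; apply: f_r. Qed.

Lemma card_le_size_inj : (#|A| <= size r)%N.
Proof.
by have := uniq_leq_size uniq_image image_sub; rewrite size_map -cardE.
Qed.

Lemma inj_onto_seq y :
  (size r <= #|A|)%N -> y \in r -> exists2 x, x \in A & f x = y.
Proof.
move=> rA yr; have [|_ imE] := uniq_min_size uniq_image image_sub.
  by rewrite size_map -cardE.
have : y \in [seq f x | x <- enum A] by rewrite imE.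
by case/mapP=> x; rewrite mem_enum => xA ->; exists x.
Qed.

End InjectiveIntoSeq.

Section OrderComplex.
Context {disp : Order.disp_t} {V : finPOrderType disp}.
Implicit Types (P Q C s : {set V}) (d : int) (c z : schain V).

HB.instance Definition _ :=
  GRing.isZmodMorphism.Build (schain V) (schain V) sboundary sboundaryB.

Definition is_chain C : bool := [forall x in C, forall y in C, (x >=< y)%O].

Lemma is_chainP C : reflect {in C &, forall x y, (x >=< y)%O} (is_chain C).
Proof.
apply: (iffP forall_inP) => [chainC x y xC yC|chainC x xC].
  exact: (forall_inP (chainC x xC)).
by apply/forall_inP=> y; apply: chainC.
Qed.

Lemma mem_order_complex P s :
  (s \in order_complex P) = (s \subset P) && is_chain s.
Proof. by rewrite inE. Qed.

Definition simplex d P s : bool :=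
  (s \in order_complex P) && (#|s|%:Z == d + 1).

Lemma simplex_sub d P s : simplex d P s -> s \subset P.
Proof. by rewrite /simplex mem_order_complex => /andP[/andP[]]. Qed.

Lemma simplexS d P Q s : P \subset Q -> simplex d P s -> simplex d Q s.
Proof.
move=> PQ; rewrite /simplex !mem_order_complex => /andP[/andP[sP ->] ->].
by rewrite (subset_trans sP).
Qed.

Lemma is_cycle_simplex d P z s :
  z \in is_cycle d P -> z s != 0 -> simplex d P s.
Proof. by case/andP=> /forallP/(_ s)/implyP. Qed.

Lemma is_cycleS d P Q z :
  P \subset Q -> z \in is_cycle d P -> z \in is_cycle d Q.
Proof.
move=> PQ zP; rewrite inE; case/andP: (zP) => _ ->; rewrite andbT.
by apply/forallP=> s; apply/implyP=> /(is_cycle_simplex zP)/(simplexS PQ).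
Qed.

Lemma proper_part_sub P : proper_part P \subset P.
Proof. by apply/subsetP=> x; rewrite inE => /andP[]. Qed.

Lemma proper_partS P Q : P \subset Q -> proper_part P \subset proper_part Q.
Proof.
move=> /subsetP PQ; apply/subsetP=> x; rewrite !inE.
move=> /and3P[/PQ-> nbot ntop] /=.
apply/andP; split; [apply: contra nbot | apply: contra ntop].
all: by move=> /forall_inP extremal; apply/forall_inP=> y /PQ; apply: extremal.
Qed.

Definition dim_le d P : Prop :=
  {in order_complex P, forall s, #|s|%:Z <= d + 1}.

Lemma dim_le_schain0 d P c : dim_le d P -> is_schain (d + 1) P c -> c = 0.
Proof.
move=> dimP /forallP cP; apply/ffunP=> s; rewrite ffunE.
apply/eqP/negPn/negP=> cs.
have /andP[/dimP + /eqP] := implyP (cP s) cs.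
by move: #|s| => k; lia.
Qed.

Lemma top_homology_basisP d P (I : finType) (z : I -> schain V) : dim_le d P ->
  homology_basis d P z <->
  (forall i, z i \in is_cycle d P) /\
  {in is_cycle d P, forall x,
    exists! a : {ffun I -> int}, x = \sum_i z i *~ a i}.
Proof.
move=> dimP.
have classE (zP : forall i, z i \in is_cycle d P) (x : cycles d P)
    (a : {ffun I -> int}) :
    \pi_(homology d P)%qT x = \sum_i homology_class (zP i) *~ a i <->
    val x = \sum_i z i *~ a i.
  have -> : \sum_i homology_class (zP i) *~ a i =
      \pi_(homology d P)%qT (\sum_i Cycle (zP i) *~ a i).
    by rewrite raddf_sum; apply: eq_bigr => i _; rewrite raddfMz.
  have -> : \sum_i z i *~ a i = val (\sum_i Cycle (zP i) *~ a i).
    by rewrite raddf_sum; apply: eq_bigr => i _; rewrite raddfMz.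
  split=> [/eqP|/val_inj->//].
  rewrite -Quotient.idealrBE inE => /asboolP[b /(dim_le_schain0 dimP)->].
  by rewrite sboundary0 raddfB => /esym/eqP; rewrite subr_eq0 => /eqP.
split=> -[zP basis].
  split=> // x xP.
  have [a [xE a_uniq]] := basis (\pi_(homology d P)%qT (Cycle xP)).
  exists a; split; first exact/(classE zP (Cycle xP)).
  by move=> b /(classE zP (Cycle xP)); apply: a_uniq.
exists zP; elim/quotW=> -[x xP].
have [a [xE a_uniq]] := basis x xP; exists a; split; first exact/classE.
by move=> b /classE; apply: a_uniq.
Qed.

(* The cycle condition at the face s :\ x. *)
Lemma dvdz_cycle_exchange d P z s x (k : int) :
    z \in is_cycle d P -> x \in s ->
    (forall y, y \notin s -> (k %| z (y |: s :\ x))%Z) ->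
  (k %| z s)%Z.
Proof.
rewrite inE => /andP[_ /eqP/ffunP/(_ (s :\ x))] + xs dvd_y.
rewrite !ffunE (bigD1 s) //= (bigD1 x) ?xs ?eqxx //= big1 ?addr0; last first.
  move=> y /andP[/andP[ys /eqP sE] yx].
  by have := setD11 y s; rewrite sE in_setD1 yx ys.
move/eqP; rewrite addr_eq0 => /eqP zsE.
rewrite -(rpredMsign _ #|[set y in s | (y < x)%O]|) zsE rpredN.
apply: rpred_sum => t ts; apply: rpred_sum => y /andP[yt /eqP tE].
have tE' : t = y |: s :\ x by rewrite -tE setD1K.
have yx : y != x by apply: contraNneq ts => yx; rewrite tE' yx setD1K.
have ysx : y \notin s :\ x by rewrite -tE setD11.
by rewrite rpredMsign tE' dvd_y // (contraNN _ ysx) // in_setD1 yx.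
Qed.

(* The cycle condition then expresses the coefficients outside H through those
   on H, by descending induction on the total weight. *)
Definition exchange_core d P (wt : V -> nat) (H : pred {set V}) : Prop :=
  forall s, simplex d P s -> ~~ H s ->
  exists2 x, x \in s &
    forall y, y \notin s -> simplex d P (y |: s :\ x) -> (wt x < wt y)%N.

Lemma dvdz_cycle_core d P wt H z (k : int) :
    exchange_core d P wt H -> z \in is_cycle d P ->
    (forall s, simplex d P s -> H s -> (k %| z s)%Z) ->
  forall s, (k %| z s)%Z.
Proof.
move=> core zP dvdH s; apply/negPn/negP=> s_ndvd.
have simplex_ndvd t : ~~ (k %| z t)%Z -> simplex d P t.
  move=> t_ndvd; apply: is_cycle_simplex zP _.
  by apply: contraNneq t_ndvd => ->; apply: dvdz0.
case: (@arg_maxnP _ s (fun t => ~~ (k %| z t)%Z)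
  (fun t => \sum_(x in t) wt x)%N) => // t t_ndvd t_max.
have [/(dvdH t (simplex_ndvd t t_ndvd))|] := boolP (H t); first exact/negP.
case/(core t (simplex_ndvd t t_ndvd))=> x xt x_lt.
case/negP: t_ndvd; apply: (dvdz_cycle_exchange zP xt) => y yt.
apply/negPn/negP=> y_ndvd; have := t_max _ y_ndvd.
rewrite /= leqNgt big_setU1 ?(big_setD1 x xt) /=; last first.
  by rewrite in_setD1 (negPf yt) andbF.
by rewrite ltn_add2r x_lt ?simplex_ndvd.
Qed.

Lemma fundamental_cycle_in d P z :
  dim_le d P -> fundamental_cycle d P z -> z \in is_cycle d P.
Proof. by move=> /top_homology_basisP basisP /basisP[/(_ tt)]. Qed.

Lemma fundamental_cycle_neq0 d P z :
  dim_le d P -> fundamental_cycle d P z -> exists s, z s != 0.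
Proof.
move=> /top_homology_basisP basisP /basisP[_ /(_ 0 (rpred0 _))[a [_ a_uniq]]].
apply/existsP; apply: contraT => /existsPn z_eq0.
have z0 : z = 0 by apply/ffunP=> s; rewrite [RHS]ffunE; apply/eqP/negPn.
have aE (b : {ffun unit -> int}) : a = b.
  by apply: a_uniq; rewrite big1 // => i _; rewrite z0 mul0rz.
by have /ffunP/(_ tt) := etrans (esym (aE 0)) (aE [ffun=> 1]); rewrite !ffunE.
Qed.

Lemma is_cycle_divz d P z (k : int) : k != 0 -> (forall s, (k %| z s)%Z) ->
  z \in is_cycle d P -> [ffun s => (z s %/ k)%Z] \in is_cycle d P.
Proof.
move=> k0 dvd_z zP; rewrite inE; set r := [ffun _ => _].
have zE : z = r *~ k by apply/ffunP=> s; rewrite ffunMzE mulrzz ffunE divzK.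
apply/andP; split.
  apply/forallP=> s; apply/implyP; rewrite ffunE => rs0.
  by apply: (is_cycle_simplex zP); apply: contraNneq rs0 => ->; rewrite div0z.
have /andP[_ /eqP/ffunP z0] := zP; apply/eqP/ffunP=> t; move/eqP: (z0 t).
by rewrite zE raddfMz ffunMzE mulrzz !ffunE mulf_eq0 (negPf k0) orbF => /eqP.
Qed.

Lemma fundamental_cycle_dvdz_unit d P z (k : int) :
    dim_le d P -> fundamental_cycle d P z -> (forall s, (k %| z s)%Z) ->
  k \is a GRing.unit.
Proof.
move=> dimP zfund dvd_z; have zP := fundamental_cycle_in dimP zfund.
have [s zs0] := fundamental_cycle_neq0 dimP zfund.
have k0 : k != 0 by apply: contraNneq zs0 => k0; rewrite -dvd0z -k0.
have [_ /(_ _ (is_cycle_divz k0 dvd_z zP))[a [rE _]]] :=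
  (top_homology_basisP _ dimP).1 zfund.
apply/unitrPr; exists (a tt); apply: (mulfI zs0).
move/ffunP/(_ s): rE; rewrite (bigD1 tt) //= big1 ?addr0; last by case.
rewrite ffunE ffunMzE mulrzz => rsE.
by rewrite mulrCA -rsE mulrC divzK ?mulr1.
Qed.

Lemma fundamental_cycle_core_unit d P wt H z s0 :
    dim_le d P -> exchange_core d P wt H ->
    (forall s, simplex d P s -> H s -> s = s0) ->
  fundamental_cycle d P z -> z s0 \is a GRing.unit.
Proof.
move=> dimP core s0_uniq zfund; apply: (fundamental_cycle_dvdz_unit dimP zfund).
apply: (dvdz_cycle_core core (fundamental_cycle_in dimP zfund)) => s sP.
by move=> /s0_uniq->.
Qed.

Lemma homology_basis_diagonal d P wt H (I : finType) (z : I -> schain V)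
    (f : I -> {set V}) :
    dim_le d P -> exchange_core d P wt H ->
    (forall i, z i \in is_cycle d P) ->
    (forall s, simplex d P s -> H s -> exists i, s = f i) ->
    (forall i, z i (f i) \is a GRing.unit) ->
    (forall i j, i != j -> z i (f j) = 0) ->
  homology_basis d P z.
Proof.
move=> dimP core zP f_onto z_diag z_offdiag; apply/(top_homology_basisP _ dimP).
have sumE (a : {ffun I -> int}) j : (\sum_i z i *~ a i) (f j) = z j (f j) * a j.
  rewrite sum_ffunE (bigD1 j) //= big1 ?addr0 => [|i ij].
    by rewrite ffunMzE mulrzz.
  by rewrite ffunMzE z_offdiag // mul0rz.
split=> // x xP; exists [ffun i => (z i (f i))^-1 * x (f i)].
split=> [|a ->]; last by apply/ffunP=> i; rewrite ffunE sumE mulKr.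
apply/eqP; rewrite -subr_eq0; apply/eqP/ffunP=> s; rewrite [RHS]ffunE.
apply/eqP; rewrite -dvd0z.
apply: (dvdz_cycle_core core) => [|{}s sP /(f_onto s sP)[i ->]].
  by rewrite rpredB // rpred_sum // => i _; rewrite rpredMz.
by rewrite dvd0z !ffunE sumE ffunE mulVKr // subrr.
Qed.

End OrderComplex.

Section SetPartitions.
Variable n : nat.
Implicit Types p q c : setpart n.

Lemma cover_setpart p : cover (val p) = [set: 'I_n].
Proof. by apply/eqP; case/and3P: (valP p). Qed.

Lemma trivIset_setpart p : trivIset (val p).
Proof. by case/and3P: (valP p). Qed.

Lemma mem_pblock_setpart p i : i \in pblock (val p) i.
Proof. by rewrite mem_pblock cover_setpart inE. Qed.

Lemma pblock_in_setpart p i : pblock (val p) i \in val p.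
Proof. by rewrite pblock_mem // cover_setpart inE. Qed.

Lemma setpart_pblockP p A :
  reflect (exists i, A = pblock (val p) i) (A \in val p).
Proof.
apply: (iffP idP) => [pA|[i ->]]; last exact: pblock_in_setpart.
have /set0Pn[i iA] : A != set0.
  by apply: contraTneq pA => ->; case/and3P: (valP p).
by exists i; rewrite (def_pblock (trivIset_setpart p) pA iA).
Qed.

Lemma same_pblock_setpart p i j :
  j \in pblock (val p) i -> pblock (val p) j = pblock (val p) i.
Proof. exact/same_pblock/trivIset_setpart. Qed.

Lemma le_setpartP p q :
  reflect (forall i, pblock (val p) i \subset pblock (val q) i) (p <= q)%O.
Proof.
apply: (iffP forall_inP) => [pq i | pq A /setpart_pblockP[i ->]].
  have /exists_inP[B qB AB] := pq _ (pblock_in_setpart p i).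
  rewrite (def_pblock (trivIset_setpart q) qB) // (subsetP AB) //.
  exact: mem_pblock_setpart.
by apply/exists_inP; exists (pblock (val q) i); rewrite ?pblock_in_setpart.
Qed.

Definition saturate q (A : {set 'I_n}) : {set 'I_n} :=
  \bigcup_(i in A) pblock (val q) i.

Lemma saturate_pblock p q i :
  (p <= q)%O -> saturate q (pblock (val p) i) = pblock (val q) i.
Proof.
move=> /le_setpartP pq; apply/setP=> j; apply/bigcupP/idP => [[k ki kj]|ij].
  by rewrite -(same_pblock_setpart (subsetP (pq i) _ ki)).
by exists i; rewrite ?mem_pblock_setpart.
Qed.

Lemma le_setpart_imset p q : (p <= q)%O -> val q = saturate q @: val p.
Proof.
move=> pq; apply/setP=> A; apply/setpart_pblockP/imsetP => [[i ->]|[B]].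
  by exists (pblock (val p) i); rewrite ?pblock_in_setpart ?saturate_pblock.
by case/setpart_pblockP=> i -> ->; exists i; rewrite saturate_pblock.
Qed.

Definition nblocks p : nat := #|val p|.

Lemma le_nblocks p q : (p <= q)%O -> (nblocks q <= nblocks p)%N.
Proof. by move=> pq; rewrite /nblocks (le_setpart_imset pq) leq_imset_card. Qed.

Lemma le_nblocks_eq p q : (p <= q)%O -> (nblocks p <= nblocks q)%N -> p = q.
Proof.
move=> pq cpq; apply/le_anti; rewrite pq /=.
have /imset_injP sat_inj : #|saturate q @: val p| == #|val p|.
  by rewrite -(le_setpart_imset pq) eqn_leq cpq le_nblocks.
apply/le_setpartP=> i; apply/subsetP=> j ij.
suff -> : pblock (val p) i = pblock (val p) j by rewrite mem_pblock_setpart.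
apply: sat_inj; rewrite ?pblock_in_setpart //.
by rewrite !saturate_pblock // (same_pblock_setpart ij).
Qed.

Lemma comparable_nblocks_le p q :
  (p >=< q)%O -> (nblocks q <= nblocks p)%N -> (p <= q)%O.
Proof. by case/orP=> // qp cqp; rewrite (le_nblocks_eq qp cqp). Qed.

Lemma is_chain_nblocks_inj (C : {set setpart n}) :
  is_chain C -> {in C &, injective nblocks}.
Proof.
move=> /is_chainP Cchain p q pC qC cpq.
by apply: le_nblocks_eq; rewrite ?cpq // comparable_nblocks_le ?Cchain ?cpq.
Qed.

Definition fiber_setpart (rT : eqType) (f : 'I_n -> rT) : setpart n :=
  exist _ (preim_partition f [set: 'I_n]) (preim_partitionP f _).

Lemma mem_pblock_fiber (rT : eqType) (f : 'I_n -> rT) i j :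
  (j \in pblock (val (fiber_setpart f)) i) = (f i == f j).
Proof.
rewrite /= /preim_partition pblock_equivalence_partition ?inE //.
by split=> // /eqP->.
Qed.

(* A lower cover x of c that splits the block of i is recovered from c and the
   block of i in x: the rest of the block of i in c is the other half. *)
Lemma lower_cover_pblock_inj x y c i :
    (x <= c)%O -> (y <= c)%O ->
    nblocks x = (nblocks c).+1 -> nblocks y = (nblocks c).+1 ->
    pblock (val x) i = pblock (val y) i ->
    pblock (val x) i != pblock (val c) i ->
  x = y.
Proof.
move=> xc yc cx cy xyi xci.
pose q := fiber_setpart (fun j => (pblock (val c) j, j \in pblock (val x) i)).
have qc : (q <= c)%O.
  apply/le_setpartP=> j; apply/subsetP=> k; rewrite mem_pblock_fiber.
  by case/eqP=> -> _; apply: mem_pblock_setpart.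
have ltqc : (nblocks c < nblocks q)%N.
  rewrite ltnNge; apply: contra xci => /(le_nblocks_eq qc) eqc.
  rewrite eqEsubset (le_setpartP _ _ xc) /=; apply/subsetP=> j; rewrite -eqc.
  by rewrite mem_pblock_fiber mem_pblock_setpart => /eqP[_ <-].
suff qE z : (z <= c)%O -> nblocks z = (nblocks c).+1 ->
    pblock (val z) i = pblock (val x) i -> z = q by rewrite (qE x) // (qE y).
move=> zc cz zxi; apply: le_nblocks_eq; last by rewrite cz.
apply/le_setpartP=> j; apply/subsetP=> k jk.
rewrite mem_pblock_fiber; apply/eqP; congr (_, _).
  by apply/esym/same_pblock_setpart; apply: (subsetP (le_setpartP _ _ zc j)).
rewrite -zxi -!(eq_pblock _ (trivIset_setpart z)) ?cover_setpart ?inE //.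
by rewrite (same_pblock_setpart jk).
Qed.

Definition part_bot : setpart n := fiber_setpart id.
Definition part_top : setpart n := fiber_setpart (fun=> tt).

Lemma pblock_bot i : pblock (val part_bot) i = [set i].
Proof. by apply/setP=> j; rewrite mem_pblock_fiber inE eq_sym. Qed.

Lemma pblock_top i : pblock (val part_top) i = setT.
Proof. by apply/setP=> j; rewrite mem_pblock_fiber inE. Qed.

Lemma le_part_bot p : (part_bot <= p)%O.
Proof.
by apply/le_setpartP=> i; rewrite pblock_bot sub1set mem_pblock_setpart.
Qed.

Lemma le_part_top p : (p <= part_top)%O.
Proof. by apply/le_setpartP=> i; rewrite pblock_top subsetT. Qed.

Lemma nblocks_bot : nblocks part_bot = n.
Proof.
suff botE : val part_bot = [set [set i] | i : 'I_n].
  by rewrite /nblocks botE card_imset ?card_ord //; apply: set1_inj.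
apply/setP=> A; apply/setpart_pblockP/imsetP => [[i ->]|[i _ ->]].
all: by exists i; rewrite ?pblock_bot.
Qed.

Lemma max_nblocks p : (nblocks p <= n)%N.
Proof. by rewrite -[leqRHS]nblocks_bot le_nblocks ?le_part_bot. Qed.

End SetPartitions.

Section MaximalChains.
Variable n : nat.
Implicit Types (x y : setpart n.+1) (C : {set setpart n.+1}) (k l : nat).

Lemma nblocks_top : nblocks (part_top n.+1) = 1%N.
Proof.
apply/eqP/cards1P; exists setT; apply/setP=> A; rewrite inE.
apply/setpart_pblockP/eqP => [[i ->]|->]; first exact: pblock_top.
by exists ord0; rewrite pblock_top.
Qed.

Lemma nblocks_gt0 x : (0 < nblocks x)%N.
Proof. by rewrite -nblocks_top le_nblocks ?le_part_top. Qed.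

Lemma nblocks_eq1 x : (nblocks x == 1%N) = (x == part_top n.+1).
Proof.
apply/eqP/eqP => [x1|->]; last exact: nblocks_top.
by apply: le_nblocks_eq; rewrite ?le_part_top ?nblocks_top ?x1.
Qed.

Lemma nblocks_eq_max x : (nblocks x == n.+1) = (x == part_bot n.+1).
Proof.
apply/eqP/eqP => [xn|->]; last exact: nblocks_bot.
by apply/esym/le_nblocks_eq; rewrite ?le_part_bot ?nblocks_bot ?xn.
Qed.

Lemma mem_iota_nblocks x : nblocks x \in iota 1 n.+1.
Proof. by rewrite mem_iota nblocks_gt0 add1n ltnS max_nblocks. Qed.

Lemma card_is_chain C : is_chain C -> (#|C| <= n.+1)%N.
Proof.
move=> /is_chain_nblocks_inj C_inj; rewrite -[leqRHS](size_iota 1).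
by apply: card_le_size_inj C_inj _ => x _; apply: mem_iota_nblocks.
Qed.

Definition max_chain C : bool := is_chain C && (#|C| == n.+1).

Definition chain_at C k : setpart n.+1 :=
  odflt (part_bot n.+1) [pick x in C | nblocks x == k].

Lemma chain_atP C k : max_chain C -> (0 < k <= n.+1)%N ->
  chain_at C k \in C /\ nblocks (chain_at C k) = k.
Proof.
move=> /andP[/is_chain_nblocks_inj C_inj /eqP cardC] kn.
have [x xC xk] : exists2 x, x \in C & nblocks x = k.
  apply: (inj_onto_seq (r := iota 1 n.+1) C_inj) => [y _||].
  - exact: mem_iota_nblocks.
  - by rewrite cardC size_iota.
  by rewrite mem_iota add1n.
rewrite /chain_at; case: pickP => [y /andP[yC /eqP yk]//|/(_ x)].
by rewrite xC xk eqxx.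
Qed.

Lemma chain_at_nblocks C x :
  max_chain C -> x \in C -> chain_at C (nblocks x) = x.
Proof.
move=> maxC xC; have [|aC a_nb] := @chain_atP C (nblocks x) maxC.
  by rewrite nblocks_gt0 max_nblocks.
by case/andP: maxC => /is_chain_nblocks_inj C_inj _; apply: C_inj.
Qed.

Lemma chain_at_le C k l : max_chain C -> (0 < k)%N -> (k <= l <= n.+1)%N ->
  (chain_at C l <= chain_at C k)%O.
Proof.
move=> maxC k0 /andP[kl ln].
have [|kC k_nb] := @chain_atP C k maxC; first by rewrite k0 (leq_trans kl).
have [|lC l_nb] := @chain_atP C l maxC; first by rewrite (leq_trans k0 kl).
have /andP[/is_chainP Cchain _] := maxC.
by apply: comparable_nblocks_le; rewrite ?Cchain ?k_nb ?l_nb.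
Qed.

Lemma max_chain_exchange_nblocks C x y :
    max_chain C -> y \notin C -> max_chain (y |: C :\ x) ->
  nblocks y = nblocks x.
Proof.
move=> maxC yC /andP[/is_chain_nblocks_inj C'_inj _].
have [|wC w_nb] := @chain_atP C (nblocks y) maxC.
  by rewrite nblocks_gt0 max_nblocks.
have [<-//|wx] := eqVneq (chain_at C (nblocks y)) x.
case/negP: yC; rewrite -(C'_inj _ _ _ _ w_nb) //; last exact: setU11.
by rewrite in_setU1 in_setD1 wx wC orbT.
Qed.

Lemma chain_at1 C : max_chain C -> chain_at C 1 = part_top n.+1.
Proof.
move=> maxC; have [//|_ /eqP] := @chain_atP C 1 maxC.
by rewrite nblocks_eq1 => /eqP.
Qed.

End MaximalChains.

Section HookPartitions.
Variable n : nat.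
Implicit Types (p q x y : setpart n.+1) (C : {set setpart n.+1}) (k : nat).

Definition last_block p : {set 'I_n.+1} := pblock (val p) ord_max.

Lemma ord_max_last_block p : ord_max \in last_block p.
Proof. exact: mem_pblock_setpart. Qed.

Lemma le_last_block p q : (p <= q)%O -> last_block p \subset last_block q.
Proof. by move/le_setpartP; apply. Qed.

Definition hook p : bool := (nblocks p + #|last_block p| == n.+2)%N.

Definition all_hook C : bool := [forall x in C, hook x].

Lemma hook_leqif p :
  (nblocks p + #|last_block p| <= n.+2 ?=
   iff [forall A : {set 'I_n.+1},
          (A \in val p) && (A != last_block p) ==> (#|A| == 1)])%N.
Proof.
have block_ge1 (A : {set 'I_n.+1}) : (A \in val p) && (A != last_block p) ->
  (1 <= #|A| ?= iff (#|A| == 1))%N.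
  case/andP=> /setpart_pblockP[i ->] _; split; last by rewrite eq_sym.
  by apply/card_gt0P; exists i; rewrite mem_pblock_setpart.
have last_in : last_block p \in val p := pblock_in_setpart p ord_max.
have := card_partition (valP p); rewrite cardsT card_ord (bigD1 _ last_in) /=.
rewrite /nblocks -sum1_card (bigD1 _ last_in) /=; have := leqif_sum block_ge1.
set s := (\sum_(A in _ | _) #|_|)%N.
set s1 := (\sum_(A in _ | _) 1)%N => -[les <-] sE.
by split; [lia | apply/eqP/eqP; lia].
Qed.

Lemma hookP p :
  reflect (forall i, i \notin last_block p -> pblock (val p) i = [set i])
          (hook p).
Proof.
rewrite /hook hook_leqif; apply: (iffP forall_inP) => [singl i iB|singl A].
  have /cards1P[j pE] : #|pblock (val p) i| == 1%N.
    apply: singl; rewrite pblock_in_setpart; apply: contraNneq iB => <-.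
    exact: mem_pblock_setpart.
  by have := mem_pblock_setpart p i; rewrite pE inE => /eqP <-.
case/andP=> /setpart_pblockP[i ->] neB; rewrite singl ?cards1 //.
by apply: contraNN neB => /same_pblock_setpart->.
Qed.

Lemma hook_le p q : hook p -> last_block p \subset last_block q -> (p <= q)%O.
Proof.
move/hookP=> hp pq; apply/le_setpartP=> i.
have [iB|iB] := boolP (i \in last_block p); last first.
  by rewrite hp // sub1set mem_pblock_setpart.
by rewrite (same_pblock_setpart iB) (same_pblock_setpart (subsetP pq i iB)).
Qed.

Lemma hook_last_block_inj : {in hook &, injective last_block}.
Proof. by move=> p q hp hq pq; apply/le_anti; rewrite !hook_le // pq. Qed.

Lemma last_block_bot : last_block (part_bot n.+1) = [set ord_max].
Proof. exact: pblock_bot. Qed.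

Lemma last_block_top : last_block (part_top n.+1) = setT.
Proof. exact: pblock_top. Qed.

Lemma hook_bot : hook (part_bot n.+1).
Proof. by rewrite /hook nblocks_bot last_block_bot cards1 addn1. Qed.

Lemma hook_top : hook (part_top n.+1).
Proof. by rewrite /hook nblocks_top last_block_top cardsT card_ord. Qed.

Lemma max_chain_hook C : max_chain C ->
    (forall k, (0 < k <= n)%N ->
       last_block (chain_at C k.+1) != last_block (chain_at C k)) ->
  all_hook C.
Proof.
move=> maxC grows; apply/forall_inP=> x xC.
rewrite /hook eqn_leq (hook_leqif x).1 /=.
rewrite -(chain_at_nblocks maxC xC).
have := nblocks_gt0 x; have := max_nblocks x.
set k := nblocks x => kn k0.
have [|_ ->] := chain_atP maxC (k := k); first by rewrite k0.
have [m kE] : exists m, (k + m = n.+1)%N by exists (n.+1 - k)%N; rewrite subnKC.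
elim: m k kE k0 {kn} => [|m IH] k kE k0.
  suff : (0 < #|last_block (chain_at C k)|)%N by move: #|_|; lia.
  by apply/card_gt0P; exists ord_max; apply: ord_max_last_block.
have := IH k.+1; rewrite addSnnS => /(_ kE isT)/leq_trans; apply.
rewrite addSnnS leq_add2l proper_card //.
by rewrite properEneq grows ?le_last_block ?chain_at_le //; lia.
Qed.

(* Once the last block stops growing along C, it must start growing again before
   the top is reached: k is the last level at which it has not grown. *)
Lemma max_chain_stall C : max_chain C -> ~~ all_hook C ->
  exists k, [/\ (1 < k <= n)%N,
    last_block (chain_at C k.+1) = last_block (chain_at C k)
  & last_block (chain_at C k) != last_block (chain_at C k.-1)].
Proof.
move=> maxC not_hook; pose stall k :=
  (0 < k <= n)%N && (last_block (chain_at C k.+1) == last_block (chain_at C k)).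
have ex_stall : exists k, stall k.
  apply: contraNP not_hook => /forallNP no_stall.
  apply: (max_chain_hook maxC) => k kn; apply/negP=> stall_k.
  by apply: (no_stall k); rewrite /stall kn.
case: (ex_minnP ex_stall) => k /andP[/andP[k0 kn] /eqP kE] k_min.
have k1 : (1 < k)%N.
  rewrite ltn_neqAle k0 andbT; apply/eqP=> k1; move: kE kn; rewrite -k1.
  rewrite chain_at1 // last_block_top => top2 n0.
  have [//|_ nb2] := chain_atP maxC (k := 2).
  have := (hook_leqif (chain_at C 2)).1.
  by rewrite nb2 top2 cardsT card_ord; lia.
exists k; split=> //; first by rewrite k1.
apply/negP=> kE'; have := k_min k.-1; rewrite /stall prednK // kE' andbT.
by lia.
Qed.

Lemma max_chain_exchange_last_block C : max_chain C -> ~~ all_hook C ->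
  exists x, [/\ x \in C, (1 < nblocks x <= n)%N
    & forall y, y \notin C -> max_chain (y |: C :\ x) ->
        (#|last_block x| < #|last_block y|)%N].
Proof.
move=> maxC /(max_chain_stall maxC)[k [/andP[k1 kn] stall grows]].
have [|xC x_nb] := chain_atP maxC (k := k); first by lia.
have [|aC a_nb] := chain_atP maxC (k := k.+1); first by lia.
have [|cC c_nb] := chain_atP maxC (k := k.-1); first by lia.
have xc : (chain_at C k <= chain_at C k.-1)%O by apply: chain_at_le => //; lia.
exists (chain_at C k); split=> [||y yC maxC']; rewrite ?x_nb ?k1 //.
set x := chain_at C k in stall grows xC x_nb xc maxC' *.
set a := chain_at C k.+1 in stall aC a_nb.
set c := chain_at C k.-1 in grows cC c_nb xc.
have y_nb := max_chain_exchange_nblocks maxC yC maxC'.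
have /andP[/is_chainP chain' _] := maxC'.
have in_C' z : z \in C -> nblocks z != nblocks x -> z \in y |: C :\ x.
  move=> zC nzx; rewrite in_setU1 in_setD1 zC andbT.
  by rewrite (contraNneq _ nzx) ?orbT // => ->.
have ay : (a <= y)%O.
  apply: comparable_nblocks_le; rewrite ?a_nb ?y_nb ?x_nb //.
  by rewrite chain' ?setU11 ?in_C' ?a_nb ?x_nb //; lia.
have yc : (y <= c)%O.
  apply: comparable_nblocks_le; rewrite ?c_nb ?y_nb ?x_nb ?leq_pred //.
  by rewrite chain' ?setU11 ?in_C' ?c_nb ?x_nb //; lia.
have xBy : last_block x \subset last_block y by rewrite -stall le_last_block.
apply: proper_card; rewrite properEneq xBy andbT; apply: contraNneq yC => xyB.
suff <- : x = y by [].
apply: (lower_cover_pblock_inj (c := c) (i := ord_max)); rewrite ?y_nb //.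
all: by rewrite x_nb c_nb; lia.
Qed.

End HookPartitions.

Section PermTails.
Variable n : nat.
Implicit Types (w u : 'S_n) (i j : nat).

Definition perm_tail w i : {set 'I_n} := [set w j | j : 'I_n & (i <= j)%N].

Lemma mem_perm_tail w i (j : 'I_n) : (w j \in perm_tail w i) = (i <= j)%N.
Proof. by rewrite mem_imset ?inE //; apply: perm_inj. Qed.

Lemma card_perm_tail w i : #|perm_tail w i| = (n - i)%N.
Proof.
rewrite card_imset; last exact: perm_inj.
rewrite -sum1dep_card -[RHS]muln1 -sum_nat_const_nat big_geq_mkord.
by apply: eq_bigl.
Qed.

Lemma perm_tail_inj w u :
  (forall i : 'I_n, perm_tail w i = perm_tail u i) -> w = u.
Proof.
move=> tailE; apply/permP=> i; pose j := (u^-1)%g (w i).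
have wuj : w i = u j by rewrite permKV.
have ij : (i <= j)%N by rewrite -(mem_perm_tail u) -wuj -tailE mem_perm_tail.
have ji : (j <= i)%N by rewrite -(mem_perm_tail w) tailE wuj mem_perm_tail.
by rewrite wuj; congr (u _); apply/val_inj/eqP; rewrite eqn_leq ij ji.
Qed.

Lemma perm_of_flag (L : nat -> {set 'I_n}) :
    (forall i j, (i <= j)%N -> L j \subset L i) ->
    (forall i, #|L i| = n - i)%N ->
  exists w : 'S_n, forall i, L i = perm_tail w i.
Proof.
move=> L_anti L_card.
have new_elt (k : 'I_n) : exists x, x \in L k :\: L k.+1.
  apply/set0Pn; rewrite -card_gt0 cardsD.
  rewrite (setIidPr (L_anti _ _ (leqnSn k))) !L_card.
  by have := ltn_ord k; lia.
have [f fE] := fin_all_exists new_elt.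
have f_in k : f k \in L k by have := fE k; rewrite inE => /andP[].
have f_lt (k l : 'I_n) : (k < l)%N -> f k != f l.
  move=> kl; have := fE k; rewrite inE => /andP[fk _].
  apply: contraNneq fk => ->.
  exact: (subsetP (L_anti _ _ kl)).
have f_inj : injective f.
  move=> k l fkl; apply/val_inj.
  by case: (ltngtP k l) => // /f_lt; rewrite fkl eqxx.
exists (perm f_inj) => i; apply/esym/eqP.
rewrite eqEcard card_perm_tail L_card leqnn andbT.
apply/subsetP=> _ /imsetP[j ij ->]; rewrite inE in ij; rewrite permE.
exact: (subsetP (L_anti _ _ ij)).
Qed.

End PermTails.

Section HookChains.
Variable n : nat.
Implicit Types (w u : 'S_n.+1) (x : setpart n.+1) (C : {set setpart n.+1}).

Lemma perm_tail0 w : perm_tail w 0 = setT.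
Proof. by apply/setP=> i; rewrite -(permKV w i) mem_perm_tail inE. Qed.

Lemma perm_tail_last w : perm_tail w n = [set w ord_max].
Proof.
apply/esym/eqP; rewrite eqEcard card_perm_tail cards1 subSnn andbT sub1set.
by rewrite mem_perm_tail leqnn.
Qed.

Definition hook_chain w : {set setpart n.+1} :=
  [set x | hook x & [exists i : 'I_n.+1, last_block x == perm_tail w i]].

Lemma hook_chainP w x :
  reflect (hook x /\ exists2 i, (i <= n)%N & last_block x = perm_tail w i)
          (x \in hook_chain w).
Proof.
rewrite inE; apply: (iffP andP) => [[hx /existsP[i /eqP xE]]|[hx [i ltin xE]]].
  by split=> //; exists i; rewrite // -ltnS.
by split=> //; apply/existsP; exists (Ordinal (ltin : i < n.+1)%N); rewrite xE.
Qed.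

Lemma card_hook_chain w : (#|hook_chain w| <= n.+1)%N.
Proof.
have tails :
    @last_block n @: hook_chain w \subset [set perm_tail w i | i : 'I_n.+1].
  apply/subsetP=> _ /imsetP[x /[!inE] /andP[_ /existsP[i /eqP->]] ->].
  exact: imset_f.
rewrite -(card_in_imset (f := @last_block n)) => [|x y]; last first.
  by rewrite !inE => /andP[hx _] /andP[hy _]; apply: hook_last_block_inj.
apply: leq_trans (subset_leq_card tails) _.
by rewrite -[leqRHS]card_ord leq_imset_card.
Qed.

Lemma max_chain_sub_hook_chain w C :
  max_chain C -> C \subset hook_chain w -> C = hook_chain w.
Proof.
case/andP=> _ /eqP cardC Cw; apply/eqP.
by rewrite eqEcard Cw cardC card_hook_chain.
Qed.

Lemma last_block_hook_chain w x :
  x \in hook_chain w -> last_block x = perm_tail w (nblocks x).-1.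
Proof.
case/hook_chainP=> /eqP + [i ltin xE]; rewrite xE card_perm_tail => nbE.
by congr perm_tail; lia.
Qed.

Lemma hook_chain_inj w u :
  max_chain (hook_chain w) -> hook_chain w = hook_chain u -> w = u.
Proof.
move=> maxC wu; apply: perm_tail_inj => i.
have [|xC x_nb] := chain_atP maxC (k := i.+1); first exact: ltn_ord.
have := xC; rewrite {2}wu => /last_block_hook_chain.
by rewrite (last_block_hook_chain xC) x_nb.
Qed.

Lemma mem_bot_hook_chain w :
  w ord_max = ord_max -> part_bot n.+1 \in hook_chain w.
Proof.
move=> wmax; apply/hook_chainP; split; first exact: hook_bot.
by exists n; rewrite // last_block_bot perm_tail_last wmax.
Qed.

Lemma mem_top_hook_chain w : part_top n.+1 \in hook_chain w.
Proof.
apply/hook_chainP; split; first exact: hook_top.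
by exists 0; rewrite // last_block_top perm_tail0.
Qed.

Lemma max_chain_hook_chain C : max_chain C -> all_hook C ->
  exists2 w : 'S_n.+1, w ord_max = ord_max & C = hook_chain w.
Proof.
move=> maxC /forall_inP hookC.
pose L i := if (i <= n)%N then last_block (chain_at C i.+1) else set0.
have L_anti i j : (i <= j)%N -> L j \subset L i.
  rewrite /L => ij; case: (leqP j n) => [jn|_]; last exact: sub0set.
  by rewrite (leq_trans ij jn) le_last_block ?chain_at_le //; lia.
have L_card i : #|L i| = (n.+1 - i)%N.
  rewrite /L; case: leqP => [ltin|ltni]; last by rewrite cards0; lia.
  have [//|xC x_nb] := chain_atP maxC (k := i.+1).
  by have /eqP := hookC _ xC; rewrite x_nb; move: #|_|; lia.
have [w wE] := perm_of_flag L_anti L_card; exists w.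
  have := ord_max_last_block (chain_at C n.+1).
  by have := wE n; rewrite /L leqnn => ->; rewrite perm_tail_last inE => /eqP.
apply: max_chain_sub_hook_chain => //; apply/subsetP=> x xC.
have nb := nblocks_gt0 x; have nb_le := max_nblocks x.
apply/hook_chainP; split; first exact: hookC.
exists (nblocks x).-1; first by lia.
have -> : last_block x = L (nblocks x).-1; last exact: wE.
by rewrite /L -ltnS prednK // nb_le chain_at_nblocks.
Qed.

End HookChains.

Section SubposetsOfPartitions.
Variable n : nat.
Implicit Types (w : 'S_n.+1) (x : setpart n.+1) (T : {set 'I_n.+1}).

Lemma last_block_Pi_perm w x : w ord_max = ord_max -> x \in Pi_perm w ->
  exists2 i, (i <= n)%N & last_block x = perm_tail w i.
Proof.
move=> wmax; rewrite inE => /existsP[I /eqP xE].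
have := pblock_in_setpart x ord_max.
rewrite {2}xE inE => /mapP[[a b] _ /= blockE].
have := ord_max_last_block x.
rewrite /last_block blockE -{1}wmax mem_imset; last exact: perm_inj.
rewrite inE /= => /andP[an nb]; exists a => //; apply/setP=> k.
rewrite -(permKV w k) mem_perm_tail mem_imset; last exact: perm_inj.
by rewrite inE (leq_trans (ltn_ord _) nb) andbT.
Qed.

Lemma part_bot_PiT T : part_bot n.+1 \in PiT T.
Proof. by rewrite inE pblock_bot eqxx. Qed.

Lemma part_top_PiT T : T != set0 -> part_top n.+1 \in PiT T.
Proof.
case/set0Pn=> i iT; rewrite inE pblock_top; apply/orP; right.
by apply/pred0Pn; exists i; rewrite /= in_setT.
Qed.

End SubposetsOfPartitions.

Lemma Pi_perm_sub_PiT n (w : 'S_n.+2) (T : {set 'I_n.+2}) :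
    w ord_max = ord_max -> w (inord n) \in T ->
  Pi_perm w \subset PiT T.
Proof.
move=> wmax wT; apply/subsetP=> x /(last_block_Pi_perm wmax)[i].
rewrite inE -/(last_block x) => + ->; rewrite leq_eqVlt => /orP[/eqP->|ltin].
  by rewrite perm_tail_last wmax eqxx.
apply/orP; right; apply/pred0Pn; exists (w (inord n)).
by rewrite /= wT andbT mem_perm_tail inordK.
Qed.

Lemma hook_chain_sub_PiT n (w : 'S_n.+2) (T : {set 'I_n.+2}) :
    ord_max \notin T -> w ord_max = ord_max ->
  max_chain (hook_chain w) -> hook_chain w \subset PiT T -> w (inord n) \in T.
Proof.
move=> maxT wmax maxC /subsetP wPiT.
have [|xC x_nb] := chain_atP maxC (k := n.+1); first by lia.
have := wPiT _ xC; rewrite inE -/(last_block _).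
rewrite (last_block_hook_chain xC) x_nb /=.
case/orP=> [/eqP/(congr1 (fun A : {set _} => #|A|))|/pred0Pn[i /andP[/=]]].
  by rewrite card_perm_tail cards1; lia.
rewrite -(permKV w i) mem_perm_tail; set j := (w^-1)%g i => nj wjT.
suff -> : inord n = j by [].
have jmax : j != ord_max by apply: contraNneq maxT => jE; rewrite -wmax -jE.
apply/val_inj; rewrite /= inordK //; apply/eqP; rewrite eqn_leq nj -ltnS.
by rewrite ltn_neqAle jmax -ltnS ltn_ord.
Qed.

Section ProperPartSimplices.
Variable n : nat.
Implicit Types (P s : {set setpart n.+2}) (x y : setpart n.+2) (w u : 'S_n.+2).
Implicit Type T : {set 'I_n.+2}.

Local Notation top_dim := (n.+2%:Z - 3).

Definition bounds : {set setpart n.+2} := [set part_bot n.+2; part_top n.+2].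

Lemma mem_bounds x : (x \in bounds) = ~~ (1 < nblocks x < n.+2)%N.
Proof.
rewrite in_set2 -nblocks_eq1 -nblocks_eq_max.
by have := nblocks_gt0 x; have := max_nblocks x; lia.
Qed.

Lemma disjoint_bounds_proper_part P s :
  s \subset proper_part P -> [disjoint bounds & s].
Proof.
move=> /subsetP sP; rewrite disjoint_sym.
apply/pred0P=> x /=; apply/negP=> /andP[/sP].
rewrite inE in_set2 => /and3P[_ not_min not_max] /orP[] /eqP xE.
  by case/negP: not_min; apply/forall_inP=> y _; rewrite xE le_part_bot.
by case/negP: not_max; apply/forall_inP=> y _; rewrite xE le_part_top.
Qed.

Lemma bounds_setUK P s :
  s \subset proper_part P -> (bounds :|: s) :\: bounds = s.
Proof.
move=> /disjoint_bounds_proper_part; rewrite disjoint_sym => disj.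
by rewrite setDUl setDv set0U; apply/setDidPl.
Qed.

Lemma is_chain_bounds_setU s : is_chain s -> is_chain (bounds :|: s).
Proof.
move=> /is_chainP s_chain; apply/is_chainP=> x y.
rewrite !in_setU !in_set1 /Order.comparable.
case/orP=> [/orP[]/eqP->|xs]; rewrite ?le_part_bot ?le_part_top ?orbT //.
case/orP=> [/orP[]/eqP->|ys]; rewrite ?le_part_bot ?le_part_top ?orbT //.
exact: s_chain.
Qed.

Lemma card_bounds_setU P s :
  s \subset proper_part P -> #|bounds :|: s| = #|s|.+2.
Proof.
move=> /disjoint_bounds_proper_part/disjoint_setI0 disj.
rewrite cardsU disj cards0 subn0 cards2.
suff -> : part_bot n.+2 != part_top n.+2 by [].
by rewrite -nblocks_eq1 nblocks_bot.
Qed.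

Lemma proper_part_dim_le P : dim_le top_dim (proper_part P).
Proof.
move=> s; rewrite mem_order_complex.
move=> /andP[sP /is_chain_bounds_setU/card_is_chain].
by rewrite (card_bounds_setU sP); move: #|s|; lia.
Qed.

Lemma simplex_max_chain P s :
  simplex top_dim (proper_part P) s -> max_chain (bounds :|: s).
Proof.
rewrite /simplex mem_order_complex => /andP[/andP[sP s_chain] cards].
rewrite /max_chain is_chain_bounds_setU //= (card_bounds_setU sP).
by move: #|s| cards; lia.
Qed.

Lemma all_hook_bounds_setU s : all_hook (bounds :|: s) = all_hook s.
Proof.
apply/forall_inP/forall_inP=> hook_s x.
  by move=> xs; rewrite hook_s // in_setU xs orbT.
rewrite !in_setU !in_set1 => /orP[/orP[]/eqP->|/hook_s //].
- exact: hook_bot.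
exact: hook_top.
Qed.

Lemma all_hook_exchange_core P :
  exchange_core top_dim (proper_part P) (fun x => #|last_block x|)
    (@all_hook n.+1).
Proof.
move=> s sP; rewrite -all_hook_bounds_setU.
case/(max_chain_exchange_last_block (simplex_max_chain sP))=> x [xC x_nb x_lt].
have xb : x \notin bounds by rewrite mem_bounds negbK.
have xs : x \in s by move: xC; rewrite in_setU (negPf xb).
exists x => // y ys yP.
have exchangeE : y |: (bounds :|: s) :\ x = bounds :|: (y |: s :\ x).
  by rewrite setDUl (setDidPl _) 1?setUCA // disjoint_sym disjoints1.
apply: x_lt; last by rewrite exchangeE (simplex_max_chain yP).
rewrite in_setU negb_or ys andbT.
have /disjointFl -> // := disjoint_bounds_proper_part (simplex_sub yP).
exact: setU11.
Qed.

Definition hook_simplex w : {set setpart n.+2} := hook_chain w :\: bounds.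

Lemma hook_simplex_inj P w u :
    w ord_max = ord_max -> u ord_max = ord_max ->
    simplex top_dim (proper_part P) (hook_simplex w) ->
  hook_simplex w = hook_simplex u -> w = u.
Proof.
move=> wmax umax /simplex_max_chain maxC wu.
have bounds_hook (v : 'S_n.+2) :
    v ord_max = ord_max -> bounds :|: hook_simplex v = hook_chain v.
  move=> vmax; rewrite /hook_simplex setDE setUIr setUCr setIT; apply/setUidPr.
  by rewrite subUset !sub1set mem_bot_hook_chain ?mem_top_hook_chain.
apply: hook_chain_inj; first by rewrite -bounds_hook.
by rewrite -!bounds_hook ?wu.
Qed.

Lemma Pi_perm_all_hook_simplex w s : w ord_max = ord_max ->
    simplex top_dim (proper_part (Pi_perm w)) s -> all_hook s ->
  s = hook_simplex w.
Proof.
move=> wmax sP /forall_inP hook_s; rewrite -(bounds_setUK (simplex_sub sP)).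
congr (_ :\: _); apply: max_chain_sub_hook_chain.
  exact: simplex_max_chain sP.
rewrite !subUset !sub1set mem_bot_hook_chain ?mem_top_hook_chain //=.
apply/subsetP=> x xs; apply/hook_chainP; split; first exact: hook_s.
apply/last_block_Pi_perm/(subsetP (proper_part_sub _)) => //.
exact: (subsetP (simplex_sub sP)).
Qed.

Lemma PiT_all_hook_simplex T s : T != set0 -> ord_max \notin T ->
    simplex top_dim (proper_part (PiT T)) s -> all_hook s ->
  exists w : 'S_n.+2,
    [/\ w ord_max = ord_max, w (inord n) \in T & s = hook_simplex w].
Proof.
move=> T_neq0 maxT sP; rewrite -all_hook_bounds_setU => hook_s.
have maxC := simplex_max_chain sP.
have [w wmax wE] := max_chain_hook_chain maxC hook_s; exists w; split=> //.
  apply: hook_chain_sub_PiT; rewrite -?wE //.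
  rewrite !subUset !sub1set part_bot_PiT part_top_PiT //=.
  exact: subset_trans (simplex_sub sP) (proper_part_sub _).
by rewrite -(bounds_setUK (simplex_sub sP)) wE.
Qed.

End ProperPartSimplices.

(* The n of the informal statement, at least 2 since T is nonempty, is n.+2. *)
Theorem theorem9p3 (n : nat) (T : {set 'I_n.+2})
  (T_neq0 : T != set0) (T_sub : T \subset [set i : 'I_n.+2 | i != ord_max])
  (rho : 'S_n.+2 -> schain (setpart n.+2))
  (rhoP : forall w : 'S_n.+2,
    fundamental_cycle (n.+2%:Z - 3) (proper_part (Pi_perm w)) (rho w)) :
  homology_basis (n.+2%:Z - 3) (proper_part (PiT T))
    (fun w : {w : 'S_n.+2 | (w ord_max == ord_max) && (w (inord n) \in T)} =>
       rho (val w)).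
Proof.
have maxT : ord_max \notin T by apply/negP=> /(subsetP T_sub); rewrite inE eqxx.
have rho_cycle w :=
  fundamental_cycle_in (@proper_part_dim_le n (Pi_perm w)) (rhoP w).
apply: (homology_basis_diagonal (f := fun w => hook_simplex (val w)))
  (@proper_part_dim_le _ _) (@all_hook_exchange_core _ _) _ _ _ _.
- case=> w /= /andP[/eqP wmax wT]; apply: is_cycleS (rho_cycle w).
  exact/proper_partS/Pi_perm_sub_PiT.
- move=> s sP /(PiT_all_hook_simplex T_neq0 maxT sP)[w [/eqP wmax wT ->]].
  by exists (exist _ w (introT andP (conj wmax wT))).
- case=> w /= /andP[/eqP wmax _].
  apply: (fundamental_cycle_core_unit (@proper_part_dim_le _ _)
    (@all_hook_exchange_core _ _) _ (rhoP w)).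
  by move=> s; apply: Pi_perm_all_hook_simplex.
case=> w /= wP [u /= uP]; rewrite -val_eqE /=; apply: contraNeq.
move=> /(is_cycle_simplex (rho_cycle w)) uS.
have [/andP[/eqP wmax _] /andP[/eqP umax _]] := (wP, uP).
apply/eqP/esym/(hook_simplex_inj umax wmax uS).
apply: Pi_perm_all_hook_simplex uS _ => //.
by apply/forall_inP=> x /setDP[/hook_chainP[]].
Qed.
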